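(* Let $G$ be a graph of order $n$ with maximum degree $\Delta=\Delta(G)$ and minimum degree $\delta=\delta(G)$. Then $$\rho(G)=L_1(G)\ \ge\ \frac{n+\Delta(\Delta-\delta)}{\Delta^2+1}\ \ge\ \frac{n}{\Delta^2+1}.$$
   Context: All graphs are finite, simple and undirected. For a vertex $v$, $N[v]$ denotes the closed neighbourhood of $v$. A vertex set $X\subseteq V(G)$ is a $1$-limited packing if $|N[v]\cap X|\le 1$ for every $v\in V(G)$ (equivalently, any two vertices of $X$ are at distance at least $3$); $L_1(G)$ is the maximum size of such a set, and the $2$-packing number is $\rho(G)=L_1(G)$. $\Delta(G)$ and $\delta(G)$ are the maximum and minimum vertex degrees. *)

(* Defs.v *)
From mathcomp Require Import all_boot all_order all_algebra.

Set Implicit Arguments.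
Unset Strict Implicit.
Unset Printing Implicit Defensive.

Record sgraph := SGraph {
  vertex :> finType;
  adj : rel vertex;
  adj_sym : symmetric adj;
  adj_irrefl : irreflexive adj }.

Section Graph.
Variable G : sgraph.
Implicit Types (u v x y : G) (X : {set G}).

Definition open_nbh v : {set G} := [set u | adj v u].

Definition closed_nbh v : {set G} := v |: open_nbh v.

Definition degree v : nat := #|open_nbh v|.

Definition max_degree : nat := \max_(v : G) degree v.

(* Every degree is at most #|G|, so the default value of the minimum is
   harmless; on the graph without vertices both max_degree and min_degree
   are 0. *)
Definition min_degree : nat := \big[minn/#|G|]_(v : G) degree v.

Definition limited_packing (k : nat) X : bool :=
  [forall v : G, #|closed_nbh v :&: X| <= k].

Definition limited_packing_number (k : nat) : nat :=
  \max_(X : {set G} | limited_packing k X) #|X|.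

(* The distance from x to y is at least d (possibly infinite): no walk
   x :: p with m < d edges ends at y. *)
Definition dist_geq (d : nat) x y : bool :=
  [forall m : 'I_d, forall p : m.-tuple G,
     path (@adj G) x p ==> (last x p != y)].

Definition two_packing X : bool :=
  [forall x in X, forall y in X, (x != y) ==> dist_geq 3 x y].

Definition two_packing_number : nat :=
  \max_(X : {set G} | two_packing X) #|X|.

End Graph.

(* Main.v *)
(** The vertices at distance at most 2 from [v] number at most
    [1 + deg v * Delta].  These balls, taken around a maximal packing, cover
    the graph; starting the packing at a vertex of minimum degree makes one
    of them have at most [1 + delta * Delta] vertices, the others having at
    most [1 + Delta ^ 2]. *)
Require Import Defs.
From mathcomp Require Import all_boot all_order all_algebra.
From mathcomp Require Import zify lra.
Import Order.TTheory GRing.Theory Num.Theory.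
Local Open Scope ring_scope.

Section Packing.
Local Open Scope nat_scope.
Variable G : sgraph.
Implicit Types (u v x y : G) (X : {set G}).

(** A union over closed neighbourhoods rather than a condition on walks: membership then means
    sharing a closed neighbourhood, which is what a packing restricts. *)
Definition ball2 v : {set G} := \bigcup_(u in closed_nbh v) closed_nbh u.

Lemma in_closed_nbh v u : (u \in closed_nbh v) = (u == v) || adj v u.
Proof. by rewrite !inE. Qed.

Lemma closed_nbh_sym v u : (u \in closed_nbh v) = (v \in closed_nbh u).
Proof. by rewrite !in_closed_nbh eq_sym adj_sym. Qed.

Lemma ball2P x y :
  reflect (exists2 v, x \in closed_nbh v & y \in closed_nbh v) (y \in ball2 x).
Proof.
by apply: (iffP bigcupP) => -[v xv yv]; exists v => //; rewrite closed_nbh_sym.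
Qed.

Lemma ball2_sym x y : (y \in ball2 x) = (x \in ball2 y).
Proof. by apply/ball2P/ball2P => -[v]; exists v. Qed.

Lemma ball2_refl x : x \in ball2 x.
Proof. by apply/ball2P; exists x; rewrite in_closed_nbh eqxx. Qed.

Lemma limited_packing1P X :
  reflect {in X &, forall x y, y \in ball2 x -> x = y} (limited_packing 1 X).
Proof.
apply: (iffP forallP) => [packX x y xX yX /ball2P[v xv yv]|sepX v].
  by apply: (card_le1_eqP (packX v)); rewrite inE ?xv ?yv.
apply/card_le1_eqP => x y /setIP[xv xX] /setIP[yv yX].
by apply: sepX => //; apply/ball2P; exists v.
Qed.

Lemma dist_geqP d x y :
  reflect (forall p, size p < d -> path (@adj G) x p -> last x p != y)
          (dist_geq d x y).
Proof.
apply: (iffP forallP) => [far p ltpd xp|far m].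
  by have /forallP/(_ (in_tuple p))/implyP := far (Ordinal ltpd); apply.
by apply/forallP => p; apply/implyP; apply: far; rewrite size_tuple.
Qed.

(** A walk with at most two edges has a vertex equal or adjacent to both ends; conversely such a
    vertex gives a walk of length 0, 1 or 2, according to which of the ends it equals. *)
Lemma dist_geq3E x y : dist_geq 3 x y = (y \notin ball2 x).
Proof.
apply/dist_geqP/idP => [far|yNx].
  apply/negP => /ball2P[v].
  rewrite !in_closed_nbh => /orP[/eqP xv|vx] /orP[/eqP yv|vy].
  - by have /eqP := far [::] isT isT; rewrite xv yv.
  - by have := far [:: y]; rewrite /= xv vy eqxx => /(_ isT isT).
  - by have := far [:: v]; rewrite /= adj_sym vx yv eqxx => /(_ isT isT).
  - by have := far [:: v; y]; rewrite /= adj_sym vx vy eqxx => /(_ isT isT).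
move=> p ltp3 xp; apply: contraNneq yNx => <-; apply/ball2P.
case: p ltp3 xp => [|u [|w []]] //= _; rewrite ?andbT => xp.
- by exists x; rewrite in_closed_nbh eqxx.
- by exists x; rewrite in_closed_nbh ?eqxx ?xp ?orbT.
- by case/andP: xp => xu uw; exists u; rewrite in_closed_nbh ?uw 1?adj_sym ?xu orbT.
Qed.

Lemma two_packingE X : two_packing X = limited_packing 1 X.
Proof.
apply/idP/limited_packing1P => [/forall_inP packX x y xX yX|sepX].
  apply: contraTeq => neq_xy; rewrite -dist_geq3E.
  by move: (packX x xX) => /forall_inP/(_ y yX)/implyP; apply.
apply/forall_inP => x xX; apply/forall_inP => y yX; apply/implyP.
by rewrite dist_geq3E; apply: contraNN => /sepX->.
Qed.

Lemma two_packing_numberE : two_packing_number G = limited_packing_number G 1.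
Proof. exact: eq_bigl two_packingE. Qed.

Lemma degree_le_max v : degree v <= max_degree G.
Proof. exact: leq_bigmax. Qed.

Lemma min_degree_le v : min_degree G <= degree v.
Proof. by rewrite /min_degree -minEnat -leEnat bigmin_le. Qed.

Lemma min_degree_attained v : exists u, degree u = min_degree G.
Proof.
case: (arg_minnP (P := xpredT) (@degree G) (isT : xpredT v)) => u _ min_u.
exists u; apply/eqP; rewrite eqn_leq min_degree_le andbT.
rewrite /min_degree; elim/big_ind: _ => [|m1 m2 *|w _].
(* The default value [#|G|] of the minimum also has to be at least [degree u]. *)
- exact: max_card.
- by rewrite leq_min; apply/andP.
- exact: min_u.
Qed.

Lemma card_bigcup_le (I T : finType) (A : {set I}) (F : I -> {set T}) :
  #|\bigcup_(i in A) F i| <= \sum_(i in A) #|F i|.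
Proof.
elim/big_rec2: _ => [|i m B _ leBm]; first by rewrite cards0.
by rewrite (leq_trans (leq_card_setU _ _)) // leq_add2l.
Qed.

(** Count [v] once; every other vertex of the ball lies in [closed_nbh u :\ v] for some neighbour
    [u] of [v]. *)
Lemma card_ball2_le v : #|ball2 v| <= 1 + degree v * max_degree G.
Proof.
have ball_sub : ball2 v \subset
    v |: \bigcup_(u in open_nbh v) (closed_nbh u :\ v).
  apply/subsetP => y /ball2P[u]; rewrite closed_nbh_sym !inE.
  case: (eqVneq y v) => //= neq_yv /predU1P[->|vu] yu.
    (* If the common vertex is [v] itself, then [y] is a neighbour of [v] and lies in its own closed
       neighbourhood. *)
    by apply/bigcupP; exists y; rewrite ?inE ?eqxx ?neq_yv //;
      case/predU1P: yu neq_yv => [->|]; rewrite ?eqxx.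
  by apply/bigcupP; exists u; rewrite ?inE ?neq_yv.
apply: leq_trans (subset_leq_card ball_sub) _.
rewrite (leq_trans (leq_card_setU _ _)) // cards1 leq_add2l.
apply: leq_trans (card_bigcup_le _ _ _ _) _.
rewrite -sum_nat_const; apply: leq_sum => u; rewrite inE => vu.
(* Removing [v] offsets counting [u] itself, so exactly [degree u] vertices remain. *)
have := cardsD1 v (closed_nbh u).
rewrite in_closed_nbh adj_sym vu orbT cardsU1 inE adj_irrefl.
by move=> /eqP; rewrite eqn_add2l => /eqP <-; apply: degree_le_max.
Qed.

(** Extend [[set v]] to a packing maximal under inclusion: a vertex outside all the balls could
    still be added. Maximum size is not asked for, so [v] can be prescribed. *)
Lemma limited_packing_cover v :
  exists X, [/\ v \in X, limited_packing 1 X &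
                [set: G] \subset \bigcup_(x in X) ball2 x].
Proof.
have pack_v : limited_packing 1 [set v].
  by apply/limited_packing1P => x y /set1P-> /set1P->.
have [X /maxsetP[packX maxX]] := maxset_exists pack_v.
rewrite sub1set => vX; exists X; split=> //.
apply/subsetP => u _; apply: contraT => uN.
have uNball x : x \in X -> u \notin ball2 x.
  by move=> xX; apply: contra uN => ux; apply/bigcupP; exists x.
suff packU : limited_packing 1 (u |: X).
  have uX : u \in X by rewrite -(maxX _ packU (subsetU1 u X)) setU11.
  by have := uNball u uX; rewrite ball2_refl.
apply/limited_packing1P => x y /setU1P[->|xX] /setU1P[->|yX] //.
- by rewrite ball2_sym (negPf (uNball y yX)).
- by rewrite (negPf (uNball x xX)).
- by move/limited_packing1P: packX; apply.
Qed.

(** The bound with its denominator cleared and the negative term moved across, so that no truncated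
    subtraction occurs. *)
Lemma card_le_limited_packing :
  #|G| + max_degree G ^ 2 <=
    limited_packing_number G 1 * (max_degree G ^ 2 + 1) +
    max_degree G * min_degree G.
Proof.
have [v _|G0] := pickP (@predT G); last first.
  by rewrite /max_degree big_pred0 // eq_card0.
have [u deg_u] := min_degree_attained v.
have [X [uX packX coverX]] := limited_packing_cover u.
have leX : #|X| <= limited_packing_number G 1 by apply: leq_bigmax_cond.
have leG : #|G| <= 1 + min_degree G * max_degree G +
                   #|X :\ u| * (max_degree G ^ 2 + 1).
  rewrite -cardsT (leq_trans (subset_leq_card coverX)) //.
  apply: leq_trans (card_bigcup_le _ _ _ _) _.
  (* The ball around [u], of minimum degree, is counted apart; this gains the term in
     [min_degree G]. *)
  rewrite (big_setD1 u) //= leq_add //; first by rewrite -deg_u card_ball2_le.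
  rewrite -sum_nat_const; apply: leq_sum => x _.
  rewrite (leq_trans (card_ball2_le x)) // addnC leq_add2r.
  by rewrite leq_mul2r degree_le_max orbT.
rewrite (cardsD1 u) uX in leX.
(* Adding [max_degree G ^ 2] to [leG] completes the ball of [u] to a full factor
   [max_degree G ^ 2 + 1]. *)
apply: leq_trans (_ : (1 + #|X :\ u|) * (max_degree G ^ 2 + 1) +
                      max_degree G * min_degree G <= _).
  by nia.
by rewrite leq_add2r leq_mul2r leX orbT.
Qed.

Lemma min_degree_le_max : min_degree G <= max_degree G.
Proof.
have [v _|G0] := pickP (@predT G).
  exact: leq_trans (min_degree_le v) (degree_le_max v).
by rewrite /min_degree big_pred0 // eq_card0.
Qed.

End Packing.

Theorem theorem2 (G : sgraph) (n : nat) (order_G : #|G| = n) :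
  let Delta : rat := (max_degree G)%:R in
  let delta : rat := (min_degree G)%:R in
  let L1 : nat := limited_packing_number G 1 in
  [/\ two_packing_number G = L1,
      (n%:R + Delta * (Delta - delta)) / (Delta ^+ 2 + 1) <= L1%:R
    & n%:R / (Delta ^+ 2 + 1)
        <= (n%:R + Delta * (Delta - delta)) / (Delta ^+ 2 + 1)].
Proof.
move=> Delta delta L1.
have Delta_gt0 : 0 < Delta ^+ 2 + 1 by rewrite ltr_wpDl ?sqr_ge0.
split; first exact: two_packing_numberE.
- rewrite ler_pdivrMr //.
  have := card_le_limited_packing G; rewrite order_G.
  rewrite -(ler_nat rat) !(natrD, natrM, natrX) -/Delta -/delta -/L1.
  lra.
(* The two numerators differ by [Delta * (Delta - delta)], a product of nonnegative factors. *)
- rewrite ler_pM2r ?invr_gt0 // lerDl mulr_ge0 ?ler0n //.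
  by rewrite subr_ge0 ler_nat min_degree_le_max.
Qed.
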